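(* Under no direct effect, the MAR assumption $\pi_\beta(R\mid X_{(1)})=\pi_\beta(R\mid X_o)$, consistency, no interference, static features and semi-offline positivity, the total-cost semi-offline value functions $$Q^t_{Semi}=\mathbb{E}_{p'}\Big[\sum_{\tau=t}^T C'^\tau_{(\overline\pi^{t+1}_\alpha)}\,\Big|\,\underline X'^{t-1},\underline A'^t,X_o\Big],\qquad V^t_{Semi}=\mathbb{E}_{p'}\Big[\sum_{\tau=t+1}^T C'^\tau_{(\overline\pi^{t+1}_\alpha)}\,\Big|\,\underline X'^t,\underline A'^t,X_o\Big]$$ satisfy $$Q_{Semi}(\underline X'^{t-1},\underline A'^t,X_o)=\mathbb{E}[C'^t\mid\underline X'^{t-1},\underline A'^t,X_o]+\sum_{X'^t}V_{Semi}(\underline X'^t,\underline A'^t,X_o)\,p(X'^t\mid\underline X'^{t-1},A'^t,X_o),$$ $$V_{Semi}(\underline X'^t,\underline A'^t,X_o)=\sum_{A'^{t+1}}Q_{Semi}(\underline X'^t,\underline A'^{t+1},X_o)\,\pi_\alpha(A'^{t+1}\mid\underline X'^t,\underline A'^t).$$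
   Context: Setting: full features $X_{(1)}\in\mathbb{R}^{d_x}$ (finitely valued), label $Y$, missingness $R\in\{0,1\}^{d_x}$ with mechanism $\pi_\beta$; $X_o$ a subset of coordinates always observed. AFA policy $\pi_\alpha(A^t\mid\underline X^{t-1},\underline A^{t-1})$ with actions in $\{1,\dots,d_x+1\}$ (acquire feature $i$ or stop at step $T$), free features $X^0$, $\underline X^t=(X^0,\dots,X^t)$, $\underline A^t=(A^1,\dots,A^t)$. Per-step costs: $C^t$ is the deterministic acquisition cost of $A^t$ for $t<T$ and the misclassification cost $g(C_{mc}\mid Y,Y^* )$ for $t=T$, with $Y^*$ from a fixed deterministic classifier of $(\underline X^{T-1},\underline A^T)$. Semi-offline sampling distribution $p'$: $(X_{(1)},Y,R)\sim p$, actions from a blocked simulation policy $\pi'_{sim}(A'^t\mid\underline X'^{t-1},\underline A'^{t-1},R)$ (never acquires features with $R_i=0$; otherwise positive wherever the simulation policy $\pi_{sim}$ is; $\pi_{sim}$ satisfies off-policy positivity w.r.t. $\pi_\alpha$), revealed features $X'^t=X_{(1),A'^t}$, simulated per-step costs $C'^t$. $C'^\tau_{(\overline\pi^{t+1}_\alpha)}$ is the potential outcome of $C'^\tau$ had actions from step $t+1$ onward followed $\pi_\alpha$. Semi-offline positivity: if a trajectory $(\underline x'^{T-1},\underline a'^T,x_o)$ has positive probability under $\pi_\alpha$ and the feature distribution, then $\pi_\beta(R\ge r'\mid x_o)>0$, with $r'$ the indicator of features acquired in $\underline a'^T$ and $\ge$ componentwise. *)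

(* Defs.v *)
From HB Require Import structures.
From mathcomp Require Import all_boot all_order all_algebra.

Set Implicit Arguments.
Unset Strict Implicit.
Unset Printing Implicit Defensive.

Import Order.TTheory GRing.Theory Num.Theory.
Local Open Scope ring_scope.

Section AFA.
Variables (R : realFieldType) (d : nat) (V Y K : finType).

Definition feat := {ffun 'I_d -> V}.
Definition miss := {ffun 'I_d -> bool}.
(* actions {1..d_x+1}: Some i = acquire feature i, None = stop *)
Definition act := option 'I_d.
(* a history of acquisitions: the list of (A^k, X^k) pairs, k = 1..t *)
Definition hist := seq ('I_d * V).

Record afa := AFA {
  obs   : {set 'I_d};                  (* indices of X_o (always observed) *)
  free  : {set 'I_d};                  (* indices of the free features X^0 *)
  pXY   : feat -> Y -> R;
  piB   : feat -> miss -> R;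
  piA   : hist -> hist -> act -> R;    (* pi_alpha(A^t | X^0, history) *)
  piSim : hist -> hist -> act -> R;    (* pi_sim(A^t | X^0, history) *)
  piS   : hist -> hist -> miss -> act -> R; (* blocked pi'_sim(A^t | X^0, hist, R) *)
  acost : 'I_d -> R;                   (* deterministic acquisition costs *)
  gmc   : Y -> Y -> K -> R;            (* g(C_mc | Y, Ystar) over finite support K *)
  cval  : K -> R;
  clf   : hist -> hist -> Y;           (* deterministic classifier Ystar *)
  Hz    : nat                          (* horizon bound: T <= Hz + 1 *)
}.

Variable M : afa.

Definition freeX (x : feat) : hist := [seq (i, x i) | i <- enum (free M)].
Definition agree (x xo : feat) : bool := [forall i in obs M, x i == xo i].
(* static features: revealed X^k = X_(1),A^k *)
Definition consistent (x : feat) (h : hist) : bool := all (fun p => x p.1 == p.2) h.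

Fixpoint wpath (f : hist -> act -> R) (pre rest : hist) : R :=
  match rest with
  | [::] => 1
  | p :: rest' => f pre (Some p.1) * wpath f (rcons pre p) rest'
  end.

Definition wsim (x : feat) (r : miss) (h : hist) : R :=
  wpath (fun h' a => piS M (freeX x) h' r a) [::] h.

Definition Emc (y ys : Y) : R := \sum_(k : K) gmc M y ys k * cval M k.

Definition Ec (x : feat) (y : Y) (h : hist) (a : act) : R :=
  match a with
  | Some i => acost M i
  | None => Emc y (clf M (freeX x) h)
  end.

(* expected sum of the remaining (potential-outcome) costs when all
   further actions follow pi_alpha, with features revealed from X_(1)
   (n = remaining fuel) *)
Fixpoint Vcf (n : nat) (x : feat) (y : Y) (h : hist) : R :=
  \sum_(a : act) piA M (freeX x) h a *
     (Ec x y h a +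
      match a with
      | Some i => if n is n'.+1 then Vcf n' x y (rcons h (i, x i)) else 0
      | None => 0
      end).

(* E[ sum_{tau=t+1}^T C^tau_(pi_alpha from t+1) | X_(1)=x, Y=y, history h ] *)
Definition Vpo (h : hist) (x : feat) (y : Y) : R := Vcf (Hz M - size h) x y h.

(* E[ sum_{tau=t}^T C^tau_(pi_alpha from t+1) | X_(1)=x, Y=y, history h, A^t=a ] *)
Definition Ccf (h : hist) (a : act) (x : feat) (y : Y) : R :=
  Ec x y h a +
  match a with
  | Some i => Vpo (rcons h (i, x i)) x y
  | None => 0
  end.

(* p'-weight of (X_(1)=x, Y=y, R=r, sampled history h, X_o = xo) *)
Definition wprefix (x : feat) (y : Y) (r : miss) (h : hist) (xo : feat) : R :=
  pXY M x y * piB M x r * (agree x xo)%:R * (consistent x h)%:R * wsim x r h.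

(* p'( history h, A^t = a, X_o = xo ) *)
Definition probQ (h : hist) (a : act) (xo : feat) : R :=
  \sum_(x : feat) \sum_(y : Y) \sum_(r : miss)
     wprefix x y r h xo * piS M (freeX x) h r a.

(* E_{p'}[ F | history h, A^t = a, X_o = xo ] *)
Definition condQ (F : feat -> Y -> R) (h : hist) (a : act) (xo : feat) : R :=
  (\sum_(x : feat) \sum_(y : Y) \sum_(r : miss)
     wprefix x y r h xo * piS M (freeX x) h r a * F x y) / probQ h a xo.

(* p'( history h, X_o = xo ) *)
Definition probV (h : hist) (xo : feat) : R :=
  \sum_(x : feat) \sum_(y : Y) \sum_(r : miss) wprefix x y r h xo.

Definition Qsemi (h : hist) (a : act) (xo : feat) : R := condQ (Ccf h a) h a xo.
Definition Vsemi (h : hist) (xo : feat) : R :=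
  (\sum_(x : feat) \sum_(y : Y) \sum_(r : miss) wprefix x y r h xo * Vpo h x y)
  / probV h xo.

Definition ECsemi (h : hist) (a : act) (xo : feat) : R :=
  condQ (fun x y => Ec x y h a) h a xo.

(* p( X_(1),i = v | revealed features of h, X_o = xo ) under the data law p *)
Definition pcond (h : hist) (i : 'I_d) (v : V) (xo : feat) : R :=
  (\sum_(x : feat) \sum_(y : Y)
      pXY M x y * (agree x xo)%:R * (consistent x (rcons h (i, v)))%:R)
  / (\sum_(x : feat) \sum_(y : Y)
      pXY M x y * (agree x xo)%:R * (consistent x h)%:R).

Definition reachA (x0 : hist) (h : hist) : R := wpath (piA M x0) [::] h.

Definition pmf_conditions : Prop :=
  ((forall x y, 0 <= pXY M x y) /\ \sum_(x : feat) \sum_(y : Y) pXY M x y = 1) /\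
      ((forall x r, 0 <= piB M x r) /\ (forall x, \sum_(r : miss) piB M x r = 1)) /\
      ((forall x0 h a, 0 <= piA M x0 h a) /\ (forall x0 h, \sum_(a : act) piA M x0 h a = 1)) /\
      ((forall x0 h a, 0 <= piSim M x0 h a) /\ (forall x0 h, \sum_(a : act) piSim M x0 h a = 1)) /\
      ((forall x0 h r a, 0 <= piS M x0 h r a) /\
        (forall x0 h r, \sum_(a : act) piS M x0 h r a = 1)) /\
      ((forall y ys k, 0 <= gmc M y ys k) /\ (forall y ys, \sum_(k : K) gmc M y ys k = 1)).

Definition MAR : Prop :=
  forall (x x' : feat) (r : miss),
    (forall i, i \in obs M -> x i = x' i) -> piB M x r = piB M x' r.

Definition obs_always : Prop :=
  forall (x : feat) (r : miss) i, 0 < piB M x r -> i \in obs M -> r i.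

Definition free_observed : Prop := free M \subset obs M.

Definition blocked : Prop :=
  forall x0 h (r : miss) i, ~~ r i -> piS M x0 h r (Some i) = 0.

Definition sim_support : Prop :=
  forall x0 h (r : miss) (a : act),
    (if a is Some i then r i else true) ->
    0 < piSim M x0 h a -> 0 < piS M x0 h r a.

Definition offpolicy_pos : Prop :=
  forall x0 h (a : act), 0 < piA M x0 h a -> 0 < piSim M x0 h a.

Definition horizon : Prop :=
  forall x0 h i, (Hz M <= size h)%N ->
    [/\ piA M x0 h (Some i) = 0, piSim M x0 h (Some i) = 0
      & forall r, piS M x0 h r (Some i) = 0].

Definition acquired (h : hist) : miss := [ffun i => i \in [seq p.1 | p <- h]].

(* pi_beta( R >= r' | X_o = xo ) *)
Definition piB_ge (xo : feat) (r' : miss) : R :=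
  (\sum_(x : feat) \sum_(y : Y) pXY M x y * (agree x xo)%:R *
      \sum_(r : miss | [forall i, r' i ==> r i]) piB M x r)
  / (\sum_(x : feat) \sum_(y : Y) pXY M x y * (agree x xo)%:R).

Definition traj_prob_A (xo : feat) (h : hist) : R :=
  \sum_(x : feat) \sum_(y : Y)
     pXY M x y * (agree x xo)%:R * (consistent x h)%:R *
     wpath (piA M (freeX x)) [::] h * piA M (freeX x) h None.

Definition semi_offline_pos : Prop :=
  forall (xo : feat) (h : hist),
    0 < traj_prob_A xo h -> 0 < piB_ge xo (acquired h).

End AFA.

(* Main.v *)
Require Import Defs.
From HB Require Import structures.
From mathcomp Require Import all_boot all_order all_algebra.
From mathcomp Require Import ring zify.
Import Order.TTheory GRing.Theory Num.Theory.
Local Open Scope ring_scope.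

(* On the event that X_(1) agrees with x_o, MAR and the observability of the
   free features make the missingness weight and the simulated-action weight
   functions of x_o alone.  Hence every p'-conditional expectation given
   (history, action, x_o) factors as (sampling weight) * (data sum) over
   (sampling weight) * (data normaliser): the sampling weight cancels and what
   remains is a conditional expectation under the data law p alone, for which
   both identities follow from the one-step Bellman recursion of the
   potential-outcome cost.  The only thing left is to show that the sampling
   weight does not vanish for actions pi_alpha may take; this is where
   semi-offline positivity enters: completing the history by pi_alpha until it
   stops yields a missingness pattern R of positive probability that reveals
   every feature acquired so far, along which pi'_sim follows pi_alpha with
   positive probability. *)

Set Implicit Arguments.
Unset Strict Implicit.

Section FieldFacts.
Variable F : fieldType.

Lemma divfMl (s x y : F) : s != 0 -> s * x / (s * y) = x / y.
Proof. by move=> s0; rewrite invfM mulrACA divff // mul1r. Qed.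

Lemma mulf_div_cancel (n p q : F) : (p = 0 -> n = 0) -> n / p * (p / q) = n / q.
Proof.
have [-> n0|p0 _] := eqVneq p 0; first by rewrite n0 // !mul0r.
by rewrite mulrA divfK.
Qed.

End FieldFacts.

Section NonnegSums.
Variable R : numDomainType.

Lemma psumr_gt0 (I : finType) (F : I -> R) j :
  (forall i, 0 <= F i) -> 0 < F j -> 0 < \sum_i F i.
Proof. by move=> F_ge0 Fj; rewrite (bigD1 j) //= ltr_wpDr ?sumr_ge0. Qed.

Lemma psumr_mul_eq0 (I : finType) (w F : I -> R) :
  (forall i, 0 <= w i) -> \sum_i w i = 0 -> \sum_i w i * F i = 0.
Proof.
move=> w_ge0 /(psumr_eq0P (fun i _ => w_ge0 i)) w0.
by rewrite big1 // => i _; rewrite w0 ?mul0r.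
Qed.

Lemma sumr_indicator (I : finType) (f : I -> R) (w : I) :
  \sum_i (w == i)%:R * f i = f w.
Proof.
rewrite (bigD1 w) //= eqxx mul1r big1 ?addr0 // => i.
by rewrite eq_sym => /negPf ->; rewrite mul0r.
Qed.

End NonnegSums.

Section Paths.
Variables (R : realFieldType) (d : nat) (V : finType).
Implicit Types (f g : hist d V -> act d -> R) (pre rest : hist d V).

Lemma wpath_rcons f pre rest p :
  wpath f pre (rcons rest p) = wpath f pre rest * f (pre ++ rest) (Some p.1).
Proof.
elim: rest pre => [|q rest IH] pre /=; first by rewrite cats0 mulr1 mul1r.
by rewrite IH mulrA cat_rcons.
Qed.

Lemma wpath_ge0 f pre rest : (forall h a, 0 <= f h a) -> 0 <= wpath f pre rest.
Proof.
move=> f_ge0; elim: rest pre => [|q rest IH] pre /=; first exact: ler01.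
by rewrite mulr_ge0.
Qed.

Lemma wpath_gt0 f g (P : pred 'I_d) pre rest :
  (forall h j, P j -> f h (Some j) != 0 -> 0 < g h (Some j)) ->
  all (fun p => P p.1) rest -> wpath f pre rest != 0 -> 0 < wpath g pre rest.
Proof.
move=> fg; elim: rest pre => [|q rest IH] pre /=; first by rewrite ltr01.
move=> /andP[Pq Prest]; rewrite mulf_eq0 negb_or => /andP[fq frest].
by rewrite mulr_gt0 ?fg ?IH.
Qed.

End Paths.

Section SemiOffline.
Variables (R : realFieldType) (d : nat) (V Y K : finType) (M : afa R d V Y K).

Hypothesis pmf : pmf_conditions M.

Lemma pXY_ge0 x y : 0 <= pXY M x y.
Proof. by case: pmf => [[]]. Qed.

Lemma piB_ge0 x r : 0 <= piB M x r.
Proof. by case: pmf => _ [[]]. Qed.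

Lemma piA_ge0 f h a : 0 <= piA M f h a.
Proof. by case: pmf => _ [_ [[]]]. Qed.

Lemma piA_sum1 f h : \sum_a piA M f h a = 1.
Proof. by case: pmf => _ [_ [[]]]. Qed.

Lemma piS_ge0 f h r a : 0 <= piS M f h r a.
Proof. by case: pmf => _ [_ [_ [_ [[]]]]]. Qed.

Definition data_weight (x : feat d V) (y : Y) (h : hist d V) (xo : feat d V) : R :=
  pXY M x y * (agree M x xo)%:R * (consistent x h)%:R.

Definition data_sum (F : feat d V -> Y -> R) (h : hist d V) (xo : feat d V) : R :=
  \sum_(x : feat d V) \sum_(y : Y) data_weight x y h xo * F x y.

Definition sampling_weight (h : hist d V) (xo : feat d V) (G : miss d -> R) : R :=
  \sum_(r : miss d) piB M xo r * wsim M xo r h * G r.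

Lemma data_weight_ge0 x y h xo : 0 <= data_weight x y h xo.
Proof. by rewrite !mulr_ge0 ?ler0n ?pXY_ge0. Qed.

Lemma data_sum_ge0 F h xo : (forall x y, 0 <= F x y) -> 0 <= data_sum F h xo.
Proof.
move=> F_ge0; apply: sumr_ge0 => x _; apply: sumr_ge0 => y _.
by rewrite mulr_ge0 ?data_weight_ge0.
Qed.

Lemma data_weight_gt0 x y h xo :
  0 < data_weight x y h xo -> [/\ 0 < pXY M x y, agree M x xo & consistent x h].
Proof.
rewrite /data_weight.
by case: (agree M x xo) (consistent x h) => [] []; rewrite ?(mulr0, mulr1, ltxx).
Qed.

Lemma consistent_rcons_natr (x : feat d V) h i v :
  (consistent x (rcons h (i, v)))%:R = (consistent x h)%:R * (x i == v)%:R :> R.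
Proof. by rewrite /consistent all_rcons -natrM mulnC mulnb. Qed.

Lemma data_sum_mul_eq0 (G F : feat d V -> Y -> R) h xo :
  (forall x y, 0 <= G x y) -> data_sum G h xo = 0 ->
  data_sum (fun x y => G x y * F x y) h xo = 0.
Proof.
move=> G_ge0 G0.
have w_ge0 x y : 0 <= data_weight x y h xo * G x y.
  by rewrite mulr_ge0 ?data_weight_ge0.
have inner0 := psumr_eq0P (fun x _ => sumr_ge0 _ (fun y _ => w_ge0 x y)) G0.
rewrite /data_sum big1 // => x _; under eq_bigr do rewrite mulrA.
exact: psumr_mul_eq0 (inner0 x isT).
Qed.

Hypothesis mar : MAR M.
Hypothesis free_obs : free_observed M.

Lemma agree_obs x xo : agree M x xo -> forall i, i \in obs M -> x i = xo i.
Proof. by move=> /forallP agr i iobs; move: (agr i); rewrite iobs => /eqP. Qed.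

Lemma freeX_agree x xo : agree M x xo -> freeX M x = freeX M xo.
Proof.
move=> agr; apply/eq_in_map => i; rewrite mem_enum => ifree.
by rewrite (agree_obs agr) // (subsetP free_obs).
Qed.

Lemma piB_agree x xo r : agree M x xo -> piB M x r = piB M xo r.
Proof. by move=> agr; apply: mar; apply: agree_obs. Qed.

Lemma wsim_agree x xo r h : agree M x xo -> wsim M x r h = wsim M xo r h.
Proof. by move=> agr; rewrite /wsim (freeX_agree agr). Qed.

Lemma sum_wprefix_factor (G : hist d V -> miss d -> R) (F : feat d V -> Y -> R) h xo
    (L : feat d V -> Y -> miss d -> R) :
  (forall x y r, L x y r = wprefix M x y r h xo * G (freeX M x) r * F x y) ->
  \sum_(x : feat d V) \sum_(y : Y) \sum_(r : miss d) L x y r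
  = sampling_weight h xo (G (freeX M xo)) * data_sum F h xo.
Proof.
move=> defL; rewrite mulr_sumr; apply: eq_bigr => x _.
rewrite mulr_sumr; apply: eq_bigr => y _; under eq_bigr do rewrite defL.
rewrite /wprefix /data_weight; have [agr|_] := boolP (agree M x xo).
  rewrite (freeX_agree agr) mulr_suml; apply: eq_bigr => r _.
  by rewrite (piB_agree _ agr) (wsim_agree _ _ agr); ring.
by rewrite !(mulr0, mul0r) big1 // => r _; rewrite !(mulr0, mul0r).
Qed.

Lemma probQ_factor h a xo : probQ M h a xo =
  sampling_weight h xo (fun r => piS M (freeX M xo) h r a) *
  data_sum (fun _ _ => 1) h xo.
Proof.
by apply: (sum_wprefix_factor (G := fun f r => piS M f h r a)) => x y r; rewrite mulr1.
Qed.

Lemma probV_factor h xo :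
  probV M h xo = sampling_weight h xo (fun _ => 1) * data_sum (fun _ _ => 1) h xo.
Proof. by apply: (sum_wprefix_factor (G := fun _ _ => 1)) => x y r; rewrite !mulr1. Qed.

Lemma condQ_data F h a xo : 0 < probQ M h a xo ->
  condQ M F h a xo = data_sum F h xo / data_sum (fun _ _ => 1) h xo.
Proof.
rewrite probQ_factor => /gt_eqF/negbT; rewrite mulf_eq0 negb_or => /andP[S0 _].
rewrite /condQ probQ_factor -[RHS](divfMl _ _ S0); congr (_ / _).
exact: (sum_wprefix_factor (G := fun f r => piS M f h r a)).
Qed.

Lemma Vsemi_data h xo : 0 < probV M h xo ->
  Vsemi M h xo = data_sum (Vpo M h) h xo / data_sum (fun _ _ => 1) h xo.
Proof.
rewrite probV_factor => /gt_eqF/negbT; rewrite mulf_eq0 negb_or => /andP[S0 _].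
rewrite /Vsemi probV_factor -[RHS](divfMl _ _ S0); congr (_ / _).
by apply: (sum_wprefix_factor (G := fun _ _ => 1)) => x y r; rewrite mulr1.
Qed.

Lemma wprefix_rcons x y r h i v xo :
  wprefix M x y r (rcons h (i, v)) xo =
  wprefix M x y r h xo * piS M (freeX M x) h r (Some i) * (x i == v)%:R.
Proof. by rewrite /wprefix /wsim wpath_rcons cat0s consistent_rcons_natr /=; ring. Qed.

Lemma Vsemi_rcons_data h i v xo : 0 < probQ M h (Some i) xo ->
  Vsemi M (rcons h (i, v)) xo =
  data_sum (fun x y => (x i == v)%:R * Vpo M (rcons h (i, v)) x y) h xo /
  data_sum (fun x _ => (x i == v)%:R) h xo.
Proof.
rewrite probQ_factor => /gt_eqF/negbT; rewrite mulf_eq0 negb_or => /andP[S0 _].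
rewrite /Vsemi /probV -[RHS](divfMl _ _ S0).
congr (_ / _); apply: (sum_wprefix_factor (G := fun f r => piS M f h r (Some i)));
  by move=> x y r; rewrite wprefix_rcons ?mulrA.
Qed.

Lemma pcond_data h i v xo : pcond M h i v xo =
  data_sum (fun x _ => (x i == v)%:R) h xo / data_sum (fun _ _ => 1) h xo.
Proof.
by congr (_ / _); apply: eq_bigr => x _; apply: eq_bigr => y _;
  rewrite /data_weight ?consistent_rcons_natr ?mulr1 ?mulrA.
Qed.

Lemma data_sum_Ccf_acquire h i xo :
  data_sum (Ccf M h (Some i)) h xo =
  data_sum (fun x y => Ec M x y h (Some i)) h xo +
  \sum_(v : V) data_sum (fun x y => (x i == v)%:R * Vpo M (rcons h (i, v)) x y) h xo.
Proof.
rewrite /data_sum [X in _ + X]exchange_big -big_split; apply: eq_bigr => x _ /=.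
rewrite [X in _ + X]exchange_big -big_split; apply: eq_bigr => y _ /=.
by rewrite -mulr_sumr -mulrDr sumr_indicator.
Qed.

Lemma Qsemi_bellman h a xo : 0 < probQ M h a xo ->
  Qsemi M h a xo =
  ECsemi M h a xo +
  match a with
  | Some i => \sum_(v : V) Vsemi M (rcons h (i, v)) xo * pcond M h i v xo
  | None => 0
  end.
Proof.
move=> Q_gt0; rewrite /Qsemi /ECsemi !condQ_data //.
case: a Q_gt0 => [i|] Q_gt0; last first.
  by rewrite addr0 /data_sum /Ccf; under eq_bigr do under eq_bigr do rewrite addr0.
rewrite data_sum_Ccf_acquire mulrDl; congr (_ + _); rewrite mulr_suml.
apply: eq_bigr => v _.
rewrite Vsemi_rcons_data // pcond_data mulf_div_cancel //.
by apply: data_sum_mul_eq0 => x y; rewrite ler0n.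
Qed.

Hypothesis horizon_bound : horizon M.

Lemma Vpo_bellman x y h :
  Vpo M h x y = \sum_a piA M (freeX M x) h a * Ccf M h a x y.
Proof.
rewrite /Vpo /Ccf; case E: (Hz M - size h)%N => [|n] /=; apply: eq_bigr => -[i|] _ //.
  have Hz_le : (Hz M <= size h)%N by rewrite -subn_eq0 E.
  by have [-> _ _] := horizon_bound (freeX M x) i Hz_le; rewrite !mul0r.
by rewrite /Vpo size_rcons subnS E.
Qed.

Lemma data_sum_Vpo h xo :
  data_sum (Vpo M h) h xo = \sum_a piA M (freeX M xo) h a * data_sum (Ccf M h a) h xo.
Proof.
rewrite /data_sum; under [RHS]eq_bigr do rewrite mulr_sumr.
rewrite [RHS]exchange_big; apply: eq_bigr => x _.
under [RHS]eq_bigr do rewrite mulr_sumr.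
rewrite [RHS]exchange_big; apply: eq_bigr => y _.
rewrite Vpo_bellman mulr_sumr; apply: eq_bigr => a _.
rewrite /data_weight; have [agr|_] := boolP (agree M x xo).
  by rewrite (freeX_agree agr); ring.
by rewrite !(mulr0, mul0r).
Qed.

Lemma exists_acquisition f h : piA M f h None = 0 ->
  exists2 j, piA M f h (Some j) != 0 & (size h < Hz M)%N.
Proof.
move=> stop; have /psumr_neq0P[a _|[j|] /andP[_ Aj]] : \sum_a piA M f h a <> 0.
- by rewrite piA_sum1; apply/eqP; rewrite oner_eq0.
- exact: piA_ge0.
- exists j; first by rewrite gt_eqF.
  rewrite ltnNge; apply/negP => Hz_le.
  by have [A0 _ _] := horizon_bound f j Hz_le; rewrite A0 ltxx in Aj.
- by rewrite stop ltxx in Aj.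
Qed.

Lemma reach_stop n (x : feat d V) f h : (Hz M - size h <= n)%N ->
  consistent x h -> wpath (piA M f) [::] h != 0 ->
  exists h', [/\ {subset map fst h <= map fst h'}, consistent x h'
                & wpath (piA M f) [::] h' * piA M f h' None != 0].
Proof.
elim: n h => [|n IH] h size_h cons_h reach_h;
  have [stop|go] := eqVneq (piA M f h None) 0;
  try by exists h; split => //; rewrite mulf_neq0.
all: have [j Aj lt_h] := exists_acquisition stop.
  by move: size_h; rewrite leqn0 subn_eq0 leqNgt lt_h.
have [||| h' [sub_h' cons_h' stop_h']] := IH (rcons h (j, x j)).
- by rewrite size_rcons; lia.
- by rewrite /consistent all_rcons /= eqxx.
- by rewrite wpath_rcons cat0s mulf_neq0.
exists h'; split => // k hk; apply: sub_h'.
by rewrite map_rcons mem_rcons in_cons hk orbT.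
Qed.

Hypothesis sim_supp : sim_support M.
Hypothesis offpolicy : offpolicy_pos M.
Hypothesis semi_pos : semi_offline_pos M.

Lemma traj_prob_A_gt0 x y xo h :
  0 < pXY M x y -> agree M x xo -> consistent x h ->
  wpath (piA M (freeX M xo)) [::] h * piA M (freeX M xo) h None != 0 ->
  0 < traj_prob_A M xo h.
Proof.
move=> pxy agr cons_h stop.
have term_ge0 x' y' : 0 <= pXY M x' y' * (agree M x' xo)%:R * (consistent x' h)%:R *
    wpath (piA M (freeX M x')) [::] h * piA M (freeX M x') h None.
  by rewrite !mulr_ge0 ?pXY_ge0 ?ler0n ?piA_ge0 ?wpath_ge0 // => ? ?; apply: piA_ge0.
apply: (psumr_gt0 (j := x)) => [x'|]; first exact: sumr_ge0.
apply: (psumr_gt0 (j := y)) => //.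
rewrite agr cons_h (freeX_agree agr) !mulr1 -mulrA mulr_gt0 // lt0r stop.
by rewrite mulr_ge0 ?piA_ge0 ?wpath_ge0 // => ? ?; apply: piA_ge0.
Qed.

Lemma semi_offline_cover xo h : 0 < traj_prob_A M xo h ->
  exists2 r : miss d, 0 < piB M xo r & forall j, j \in map fst h -> r j.
Proof.
move=> /semi_pos; rewrite /piB_ge.
set cover := fun x : feat d V =>
  \sum_(r : miss d | [forall i, acquired h i ==> r i]) piB M x r.
have cover_ge0 x : 0 <= cover x by apply: sumr_ge0 => r _; apply: piB_ge0.
have term_ge0 x y : 0 <= pXY M x y * (agree M x xo)%:R * cover x.
  by rewrite !mulr_ge0 ?pXY_ge0 ?ler0n.
move=> pos; have /psumr_neq0P[x _|x /andP[_]] : \sum_x \sum_y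
    pXY M x y * (agree M x xo)%:R * cover x <> 0.
- by move=> N0; rewrite N0 mul0r ltxx in pos.
- exact: sumr_ge0.
move=> /gt_eqF/negbT/eqP/psumr_neq0P[y _|y /andP[_]]; first exact: term_ge0.
have [agr|_] := boolP (agree M x xo); last by rewrite mulr0 mul0r ltxx.
rewrite mulr1 => /gt_eqF/negbT; rewrite mulf_eq0 negb_or => /andP[_ /eqP].
case/psumr_neq0P => [r _|r /andP[covers Br]]; first exact: piB_ge0.
exists r; first by rewrite -(piB_agree r agr).
by move=> j hj; move/forallP: covers => /(_ j); rewrite ffunE hj.
Qed.

Lemma probV_witness h xo : 0 < probV M h xo ->
  exists x y, [/\ 0 < pXY M x y, agree M x xo & consistent x h].
Proof.
rewrite probV_factor => /gt_eqF/negbT; rewrite mulf_eq0 negb_or => /andP[_ /eqP].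
case/psumr_neq0P => [x _|x /andP[_ /gt_eqF/negbT/eqP]].
  by apply: sumr_ge0 => y _; rewrite mulr1 data_weight_ge0.
case/psumr_neq0P => [y _|y /andP[_]]; first by rewrite mulr1 data_weight_ge0.
by rewrite mulr1 => /data_weight_gt0; exists x, y.
Qed.

Lemma exists_covering_miss h xo a :
  0 < probV M h xo -> 0 < reachA M (freeX M xo) h -> 0 < piA M (freeX M xo) h a ->
  exists2 r : miss d, 0 < piB M xo r &
    all (fun p => r p.1) h && (if a is Some i then r i else true).
Proof.
move=> /probV_witness[x [y [pxy agr cons_h]]] reach_h Aa.
have [h1 [sub_h1 a_h1 cons_h1 reach_h1]] : exists h1,
    [/\ {subset map fst h <= map fst h1}, (if a is Some i then i \in map fst h1 else true),
        consistent x h1 & wpath (piA M (freeX M xo)) [::] h1 != 0].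
  case: a Aa => [i|] Aa; last by exists h; split; rewrite // gt_eqF.
  exists (rcons h (i, x i)); split.
  - by move=> j hj; rewrite map_rcons mem_rcons in_cons hj orbT.
  - by rewrite map_rcons mem_rcons mem_head.
  - by rewrite /consistent all_rcons /= eqxx.
  - by rewrite wpath_rcons cat0s mulf_neq0 ?gt_eqF.
have [h2 [sub_h2 cons_h2 stop_h2]] := reach_stop (leqnn _) cons_h1 reach_h1.
have [r Br covers] := semi_offline_cover (traj_prob_A_gt0 pxy agr cons_h2 stop_h2).
exists r => //; apply/andP; split.
  by apply/allP => p hp; apply/covers/sub_h2/sub_h1/map_f.
by case: a a_h1 {Aa} => // i /sub_h2/covers.
Qed.

Lemma probQ_gt0 h a xo :
  0 < probV M h xo -> 0 < reachA M (freeX M xo) h -> 0 < piA M (freeX M xo) h a ->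
  0 < probQ M h a xo.
Proof.
move=> V_gt0 reach_h Aa.
have [r Br /andP[covers_h covers_a]] := exists_covering_miss V_gt0 reach_h Aa.
have piS_gt0 h' a' : (if a' is Some j then r j else true) ->
    0 < piA M (freeX M xo) h' a' -> 0 < piS M (freeX M xo) h' r a'.
  by move=> ra' Aa'; apply: sim_supp => //; apply: offpolicy.
rewrite probQ_factor mulr_gt0 //.
  apply: (psumr_gt0 (j := r)) => [r'|].
    by rewrite !mulr_ge0 ?piB_ge0 ?piS_ge0 ?wpath_ge0 // => ? ?; apply: piS_ge0.
  rewrite !mulr_gt0 ?piS_gt0 //.
  apply: (wpath_gt0 (f := piA M (freeX M xo)) _ covers_h); last by rewrite gt_eqF.
  by move=> h' j rj Aj; apply: piS_gt0; rewrite // lt0r Aj piA_ge0.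
move: V_gt0; rewrite probV_factor => /gt_eqF/negbT.
rewrite mulf_eq0 negb_or => /andP[_ D0].
by rewrite lt0r D0 data_sum_ge0.
Qed.

Lemma Vsemi_bellman h xo : 0 < probV M h xo -> 0 < reachA M (freeX M xo) h ->
  Vsemi M h xo = \sum_a Qsemi M h a xo * piA M (freeX M xo) h a.
Proof.
move=> V_gt0 reach_h; rewrite Vsemi_data // data_sum_Vpo mulr_suml.
apply: eq_bigr => a _; have [A0|Aa] := eqVneq (piA M (freeX M xo) h a) 0.
  by rewrite A0 !mul0r mulr0.
rewrite /Qsemi condQ_data; first by rewrite -mulrA mulrC.
by apply: probQ_gt0; rewrite // lt0r Aa piA_ge0.
Qed.

End SemiOffline.

Unset Implicit Arguments.

Theorem corollary2 (R : realFieldType) (d : nat) (V Y K : finType)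
  (M : afa R d V Y K) :
  pmf_conditions M -> MAR M -> obs_always M -> free_observed M ->
  blocked M -> sim_support M -> offpolicy_pos M -> horizon M ->
  semi_offline_pos M ->
  (forall (h : hist d V) (a : act d) (xo : feat d V),
     0 < probQ M h a xo ->
     Qsemi M h a xo =
       ECsemi M h a xo +
       match a with
       | Some i => \sum_(v : V) Vsemi M (rcons h (i, v)) xo * pcond M h i v xo
       | None => 0
       end)
  /\
  (forall (h : hist d V) (xo : feat d V),
     0 < probV M h xo -> 0 < reachA M (freeX M xo) h ->
     Vsemi M h xo = \sum_(a : act d) Qsemi M h a xo * piA M (freeX M xo) h a).
Proof.
move=> pmf mar _ free_obs _ sim_supp offpolicy horizon_bound semi_pos; split.
  exact: Qsemi_bellman.
exact: Vsemi_bellman.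
Qed.
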